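(* Each strongly pre-topological group $G$ is completely regular.
   Context: A pre-topology on a set $Z$ is a family $\mathscr{T}\subseteq 2^{Z}$ with $\bigcup\mathscr{T}=Z$ such that $\bigcup\mathscr{T}'\in\mathscr{T}$ for every $\mathscr{T}'\subseteq\mathscr{T}$; its members are called open and their complements closed. A map between pre-topological spaces is pre-continuous if preimages of open sets are open. For a pre-topological space $G$, $G\times G$ carries the product pre-topology, whose open sets are the unions of sets $O_1\times O_2$ with $O_1,O_2$ open in $G$. A pre-topological group is a group $G$ that is also a pre-topological space such that multiplication $G\times G\to G$, $(x,y)\mapsto x\cdot y$, and inversion $G\to G$, $x\mapsto x^{-1}$, are pre-continuous. A pre-base at the identity $e$ is a family $\mathscr{B}_e$ of open sets containing $e$ such that every open set containing $e$ contains a member of $\mathscr{B}_e$; it is symmetric if $U=U^{-1}$ for every $U\in\mathscr{B}_e$. A pre-topological group $G$ is a strongly pre-topological group if it has a symmetric pre-base $\mathscr{B}_e$ at the identity $e$ such that for each $U\in\mathscr{B}_e$ there exists $V\in\mathscr{B}_e$ with $V^2\subseteq U$, where $V^2=\{vw:v,w\in V\}$. A pre-topological space $Z$ is $T_1$ if for any $y\neq z$ in $Z$ there are open $V,W$ with $V\cap\{y,z\}=\{y\}$ and $W\cap\{y,z\}=\{z\}$. It is completely regular if it is $T_1$ and for each $z\in Z$ and each closed $C\subseteq Z$ with $z\notin C$ there is a pre-continuous map $r:Z\to I$ with $r(z)=0$ and $r(x)=1$ for each $x\in C$, where $I=[0,1]$ is the closed unit interval with its usual topology.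
   Formalization: The T_1 part of complete regularity is proved only when G is T_0 (a nontrivial group with only the empty set and G open is strongly pre-topological but not T_1); the separation of points from closed sets by maps to [0,1] is proved for every strongly pre-topological group. *)

(* Defs.v *)
From HB Require Import structures.
From mathcomp Require Import all_boot all_order all_algebra.
From mathcomp Require Import all_classical all_reals all_analysis.

Set Implicit Arguments.
Unset Strict Implicit.
Unset Printing Implicit Defensive.

Import Order.TTheory GRing.Theory Num.Theory.
Import numFieldNormedType.Exports.

Local Open Scope classical_set_scope.

(* Finite intersections of open sets need not be open. The empty set is always
   open, by pre_open_bigcup with F := set0. *)
Record pretopology (Z : Type) := Pretopology {
  pre_open : set (set Z);
  pre_open_cover : \bigcup_(O in pre_open) O = [set: Z];
  pre_open_bigcup : forall F : set (set Z),
    F `<=` pre_open -> pre_open (\bigcup_(O in F) O)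
}.

Definition pre_closed (Z : Type) (T : pretopology Z) (C : set Z) : Prop :=
  pre_open T (~` C).

Definition pre_continuous (X Y : Type) (TX : pretopology X)
    (TY : pretopology Y) (f : X -> Y) : Prop :=
  forall O : set Y, pre_open TY O -> pre_open TX (f @^-1` O).

Section product.
Variables (X Y : Type) (TX : pretopology X) (TY : pretopology Y).

Definition prod_pre_open : set (set (X * Y)) :=
  [set W | exists2 F : set (set X * set Y),
     (forall O, F O -> pre_open TX O.1 /\ pre_open TY O.2) &
     W = \bigcup_(O in F) (O.1 `*` O.2)].

Lemma prod_pre_open_cover : \bigcup_(W in prod_pre_open) W = [set: X * Y].
Proof.
apply/seteqP; split => // -[x y] _.
have [A TA Ax] : (\bigcup_(O in pre_open TX) O) x by rewrite pre_open_cover.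
have [B TB By] : (\bigcup_(O in pre_open TY) O) y by rewrite pre_open_cover.
exists (A `*` B) => //; exists [set (A, B)]; first by move=> _ ->.
by rewrite bigcup_set1.
Qed.

Lemma prod_pre_open_bigcup (H : set (set (X * Y))) :
  H `<=` prod_pre_open -> prod_pre_open (\bigcup_(W in H) W).
Proof.
move=> HP.
exists [set O : set X * set Y | [/\ pre_open TX O.1, pre_open TY O.2 &
                  O.1 `*` O.2 `<=` \bigcup_(W in H) W]].
  by move=> O [].
apply/seteqP; split => [p [W HW Wp]|p [U [_ _ OH] Op]]; last exact: OH.
have [F FO WF] := HP _ HW; move: (Wp); rewrite WF => -[U FU Up].
exists U => //=; have [U1 U2] := FO _ FU; split=> // q Oq.
by exists W => //; rewrite WF; exists U.
Qed.

Definition prod_pretopology : pretopology (X * Y) :=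
  Pretopology prod_pre_open_cover prod_pre_open_bigcup.

End product.

Section topological.
Variable X : topologicalType.

Lemma open_cover_setT : \bigcup_(O in @open X) O = [set: X].
Proof. by apply/seteqP; split => // x _; exists setT => //; exact: openT. Qed.

Lemma open_bigcup_sub (F : set (set X)) :
  F `<=` open -> open (\bigcup_(O in F) O).
Proof. by move=> FO; apply: bigcup_open => O /FO. Qed.

Definition pretopology_of_topology : pretopology X :=
  Pretopology open_cover_setT open_bigcup_sub.

End topological.

(* As a type, `[0, 1] carries the subspace topology inherited from R. *)
Definition unit_interval (R : realType) : set R := `[0%R, 1%R].
Arguments unit_interval R : clear implicits.

Definition unit_interval_pretopology (R : realType) :
    pretopology (unit_interval R) :=
  pretopology_of_topology (unit_interval R).

Section separation.
Variables (R : realType) (Z : Type) (T : pretopology Z).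

Definition pre_T0 : Prop :=
  forall y z : Z, y <> z -> exists2 V : set Z, pre_open T V &
    V `&` [set y; z] = [set y] \/ V `&` [set y; z] = [set z].

Definition pre_T1 : Prop :=
  forall y z : Z, y <> z -> exists V W : set Z,
    [/\ pre_open T V, pre_open T W,
        V `&` [set y; z] = [set y] & W `&` [set y; z] = [set z]].

Definition points_closed_functionally_separated : Prop :=
  forall (z : Z) (C : set Z), pre_closed T C -> ~ C z ->
  exists r : Z -> unit_interval R,
    [/\ pre_continuous T (unit_interval_pretopology R) r,
        set_val (r z) = 0%R & forall x, C x -> set_val (r x) = 1%R].

Definition completely_regular : Prop :=
  pre_T1 /\ points_closed_functionally_separated.

End separation.

Section groups.
Variables (G : groupType) (T : pretopology G).

Definition pretopological_group : Prop :=
  pre_continuous (prod_pretopology T T) T (fun p : G * G => (p.1 * p.2)%g) /\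
  pre_continuous T T (fun x : G => (x^-1)%g).

Definition prebase_at_identity (B : set (set G)) : Prop :=
  (forall U, B U -> pre_open T U /\ U 1%g) /\
  (forall O, pre_open T O -> O 1%g -> exists2 U, B U & U `<=` O).

Definition symmetric_family (B : set (set G)) : Prop :=
  forall U, B U -> U = [set (x^-1)%g | x in U].

Definition strongly_pretopological_group : Prop :=
  pretopological_group /\
  exists B : set (set G),
    [/\ prebase_at_identity B, symmetric_family B &
        forall U, B U -> exists2 V, B V &
          [set (v * w)%g | v in V & w in V] `<=` U].

End groups.

(* Main.v *)
Require Import Defs.
From HB Require Import structures.
From mathcomp Require Import all_boot all_order all_algebra.
From mathcomp Require Import all_classical all_reals all_analysis.

Set Implicit Arguments.
Unset Strict Implicit.
Unset Printing Implicit Defensive.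

Import Order.TTheory GRing.Theory Num.Theory.
Import numFieldNormedType.Exports.

Local Open Scope classical_set_scope.

(** A function into the interval is pre-continuous if it is continuous for some
genuine topology coarser than the given pre-topology, and the proof looks for
such a topology. What may fail in a pre-topology is that two open neighbourhoods
of a point have a common refinement, but openness is still a local property: a
set is open as soon as each of its points has one open neighbourhood inside it
([pre_open_local]). This is enough to recognize a coarser topology.

Let the point [z] lie outside the closed set [C]. Translating by [z] and
shrinking gives a symmetric member [U 0] of the pre-base at the identity with
[z * U 0] disjoint from [C]. Halving repeatedly gives symmetric members [U n]
of the pre-base with [U n.+1 * U n.+1] included in [U n]
([prebase_halving_sequence]). Such a sequence is decreasing, so the relations
[x^-1 * y \in U n] do form a base of a uniformity, even though the
intersection of two members of the pre-base need not contain a third. Each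
uniform neighbourhood of [x] contains some translate [x * U n], which is open
because multiplication is pre-continuous, so this uniform topology is coarser
than the pre-topology ([halving_continuous_pre_open]). The entourage of [U 0] separates [z] from [C],
and the Urysohn function of uniform spaces is the one sought
([halving_urysohn]).

For the T_1 axiom, if [V] is open and contains [y] but not [z], then a
symmetric [U] with [y * U] included in [V] satisfies: [z] is not in [y * U], so
by symmetry [y] is not in the open set [z * U]. Thus T_0 gives T_1
([strongly_separate]). *)

(** * Openness in a pre-topology *)

(** This replaces the intersection axiom of a topology: openness is proved
by exhibiting a single open neighbourhood of each point. *)
Lemma pre_open_local (Z : Type) (T : pretopology Z) (W : set Z) :
  (forall x, W x -> exists O, [/\ pre_open T O, O x & O `<=` W]) ->
  pre_open T W.
Proof.
move=> WT.
have -> : W = \bigcup_(O in [set O | pre_open T O /\ O `<=` W]) O.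
  apply/seteqP; split=> [x /WT[V [TV Vx VW]]|x [V [_ VW]]]; last exact: VW.
  by exists V.
by apply: pre_open_bigcup => O [].
Qed.

(** The slice at [x] of a union of open boxes is the union of the second sides
of those boxes whose first side contains [x]. *)
Lemma pre_open_ltranslate (G : groupType) (T : pretopology G) (x : G)
    (O : set G) :
  pretopological_group T -> pre_open T O ->
  pre_open T [set y | O (x * y)%g].
Proof.
move=> [mulT _] /mulT[F FO OF]; apply: pre_open_local => y Oxy.
have : ((fun p : G * G => (p.1 * p.2)%g) @^-1` O) (x, y) by [].
rewrite OF => -[P FP [/= P1x P2y]]; exists P.2; split=> //.
  by have [] := FO _ FP.
move=> w P2w; suff : ((fun p : G * G => (p.1 * p.2)%g) @^-1` O) (x, w) by [].
by rewrite OF; exists P.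
Qed.

(** * The uniformity generated by a halving sequence of subsets *)

Section halving.
Variables (G : groupType) (U : nat -> set G).

(** These axioms give a uniformity on the group although the members of the
sequence are unrelated to conjugation: only the left-invariant relations
[x^-1 * y \in U n] are used, never right-invariant ones. *)
Record halving_sequence : Prop := HalvingSequence {
  halving1 : forall n, U n 1%g;
  halvingV : forall n x, U n x -> U n (x^-1)%g;
  halvingM : forall n x y, U n.+1 x -> U n.+1 y -> U n (x * y)%g
}.

Hypothesis hU : halving_sequence.

Lemma halving_anti m n : (m <= n)%N -> U n `<=` U m.
Proof.
move=> /subnK <-; elim: (n - m)%N => [//|k IHk] x Ux; apply: IHk.
by rewrite -[x]mulg1; apply: (halvingM hU) => //; exact: halving1.
Qed.

Definition halving_ent : set_system (G * G) :=
  filter_from setT (fun n => [set p | U n (p.1^-1 * p.2)%g]).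

Lemma halving_ent_filter : Filter halving_ent.
Proof.
apply: filter_from_filter; first by exists 0%N.
move=> i j _ _; exists (maxn i j) => // p /= Up.
by split; apply: halving_anti Up; rewrite (leq_maxl, leq_maxr).
Qed.

Lemma halving_ent_diagonal A : halving_ent A -> diagonal `<=` A.
Proof.
move=> [n _ UA] p /esym pE; apply: UA.
by rewrite /= pE mulVg; exact: halving1.
Qed.

Lemma halving_ent_inv A : halving_ent A -> halving_ent (A^-1)%relation.
Proof.
move=> [n _ UA]; exists n => // -[x y] /= /(halvingV hU) Uxy; apply: UA => /=.
by rewrite invgM invgK in Uxy.
Qed.

Lemma halving_ent_split A : halving_ent A ->
  exists2 B, halving_ent B & (B \; B)%relation `<=` A.
Proof.
move=> [n _ UA]; exists [set p | U n.+1 (p.1^-1 * p.2)%g]; first by exists n.+1.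
move=> [x y] /= [z /= Uxz Uzy]; apply: UA => /=.
by rewrite -[y](mulVKg z) mulgA; exact: (halvingM hU).
Qed.

End halving.

(** The proof [hU] is a parameter of the type so that the uniform structure,
which depends on it, can be attached to an alias of the bare group. *)
Definition halving_space (G : groupType) (U : nat -> set G)
  (hU : halving_sequence U) : Type := G.

HB.instance Definition _ G U hU := Choice.on (@halving_space G U hU).
HB.instance Definition _ G U hU := isUniform.Build (@halving_space G U hU)
  (halving_ent_filter hU) (halving_ent_diagonal hU) (@halving_ent_inv G U hU)
  (@halving_ent_split G U hU).

(** The hypothesis says that the entourage of [U 0] does not meet [A * B],
which is what the uniform version of Urysohn's lemma asks for. *)
Lemma halving_urysohn (R : realType) (G : groupType) (U : nat -> set G)
    (hU : halving_sequence U) (A B : set G) :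
  (forall a b, A a -> B b -> ~ U 0%N (a^-1 * b)%g) ->
  exists f : halving_space hU -> R,
    [/\ continuous f, range f `<=` `[0%R, 1%R],
        forall a, A a -> f a = 0%R & forall b, B b -> f b = 1%R].
Proof.
move=> AB.
have sep : @uniform_separator (halving_space hU) A B.
  apply: uniform_separatorW; exists [set p | U 0%N (p.1^-1 * p.2)%g].
    by exists 0%N.
  by apply/eqP/negPn/negP => /set0P[[a b] /= [[Aa Bb]]]; exact: AB.
exists (@Urysohn (halving_space hU) R A B); split.
- exact: Urysohn_continuous.
- exact: Urysohn_range.
- by move=> a Aa; apply: (Urysohn_sub0 sep); exists a.
- by move=> b Bb; apply: (Urysohn_sub1 sep); exists b.
Qed.

(** The uniform topology is coarser than the pre-topology: a uniform
neighbourhood of [x] contains a translate [x * U n], and one open neighbourhood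
per point suffices. *)
Lemma halving_continuous_pre_open (G : groupType) (T : pretopology G)
    (U : nat -> set G) (hU : halving_sequence U) (X : topologicalType)
    (f : halving_space hU -> X) (O : set X) :
  pretopological_group T -> (forall n, pre_open T (U n)) ->
  continuous f -> open O -> pre_open T (f @^-1` O).
Proof.
move=> GT UT fC oO; apply: pre_open_local => x Ofx.
have : nbhs (x : halving_space hU) (f @^-1` O).
  by apply: fC; apply: open_nbhs_nbhs.
move=> [E [n _ UE] EO].
exists [set y | U n (x^-1 * y)%g]; split.
- exact: pre_open_ltranslate.
- by rewrite /= mulVg; exact: halving1.
- by move=> y Uy; apply: EO; apply/mem_set/UE.
Qed.

(** * Separation *)

(** Dependent choice, in the form of the iteration of a choice function for the
halving property. *)
Lemma prebase_halving_sequence (G : groupType) (B : set (set G)) (U0 : set G) :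
  (forall U, B U -> U 1%g) -> symmetric_family B ->
  (forall U, B U -> exists2 V, B V &
     [set (v * w)%g | v in V & w in V] `<=` U) ->
  B U0 -> exists2 U : nat -> set G, halving_sequence U &
    U 0%N = U0 /\ forall n, B (U n).
Proof.
move=> B1 Bsym Bsq BU0.
(* The implication makes the choice function total; outside the pre-base its
   value is immaterial. *)
have /choice[h hP] : forall U, exists V, B U ->
    B V /\ [set (v * w)%g | v in V & w in V] `<=` U.
  move=> U; have [/Bsq[V BV VU]|nBU] := pselect (B U); first by exists V.
  by exists U.
pose U n := iter n h U0.
have BU n : B (U n) by elim: n => //= n /hP[].
exists U => //; split=> [n|n x Ux|n x y Ux Uy]; first exact: B1.
  by rewrite (Bsym _ (BU n)); exists x.
by have [_] := hP _ (BU n); apply; exists x => //; exists y.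
Qed.

Lemma strongly_functionally_separated (R : realType) (G : groupType)
    (T : pretopology G) :
  strongly_pretopological_group T -> points_closed_functionally_separated R T.
Proof.
move=> [GT [B [[Bopen Bbase] Bsym Bsq]]] z C TC nCz.
(* [U0] is chosen inside the translate of the complement of [C] that sends [z]
   to the identity. *)
have [|U0 BU0 U0C] := Bbase _ (pre_open_ltranslate z GT TC).
  by rewrite /= mulg1.
have [|U hU [U0E BU]] := prebase_halving_sequence _ Bsym Bsq BU0.
  by move=> V /Bopen[].
have [|f [fC f01 fz fCl]] := @halving_urysohn R _ _ hU [set z] C.
  by move=> _ c -> Cc; rewrite U0E => /U0C /=; rewrite mulVKg; exact.
have f01' x : f x \in unit_interval R by apply/mem_set/f01; exists x.
exists (fun x => exist _ (f x) (f01' x) : unit_interval R).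
split; [|exact: fz|exact: fCl].
(* An open set of the interval is the trace of an open set [Q] of the line. *)
move=> _ [Q oQ <-].
apply: (halving_continuous_pre_open GT _ fC oQ) => n.
by have [] := Bopen _ (BU n).
Qed.

(** If [y * U] avoids [z] and [U] is symmetric, then [z * U] avoids [y]. This
exchanges the roles of the two points. *)
Lemma strongly_separate (G : groupType) (T : pretopology G) (V : set G)
    (y z : G) :
  strongly_pretopological_group T -> pre_open T V -> V y -> ~ V z ->
  exists W, [/\ pre_open T W, W z & ~ W y].
Proof.
move=> [GT [B [[Bopen Bbase] Bsym _]]] TV Vy nVz.
have [|U BU UV] := Bbase _ (pre_open_ltranslate y GT TV).
  by rewrite /= mulg1.
have [TU U1] := Bopen _ BU.
exists [set w | U (z^-1 * w)%g]; split.
- exact: pre_open_ltranslate.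
- by rewrite /= mulVg.
- move=> /= Uzy; apply: nVz.
  suff /UV : U (y^-1 * z)%g by rewrite /= mulVKg.
  by rewrite (Bsym _ BU); exists (z^-1 * y)%g => //; rewrite invgM invgK.
Qed.

Lemma setI_pairP (Z : Type) (V : set Z) (y z : Z) : y <> z ->
  V `&` [set y; z] = [set y] <-> V y /\ ~ V z.
Proof.
move=> yz; split=> [VE|[Vy nVz]].
  split; first by have [] : (V `&` [set y; z]) y by rewrite VE.
  move=> Vz; apply: yz.
  by have /esym : [set y] z by rewrite -VE; split=> //; right.
apply/seteqP; split=> [x [Vx [//|xz]]|x -> /=]; first by rewrite xz in Vx.
by split=> //; left.
Qed.

Lemma strongly_T0_T1 (G : groupType) (T : pretopology G) :
  strongly_pretopological_group T -> pre_T0 T -> pre_T1 T.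
Proof.
move=> GT T0.
suff sepT (y z : G) (V : set G) : y <> z -> pre_open T V ->
    V `&` [set y; z] = [set y] -> exists V W, [/\ pre_open T V, pre_open T W,
      V `&` [set y; z] = [set y] & W `&` [set y; z] = [set z]].
  move=> y z yz; have [V TV [|]] := T0 _ _ yz; first exact: sepT.
  rewrite setUC => /(sepT _ _ _ (nesym yz) TV)[V' [W' [TV' TW' V'E W'E]]].
  by exists W', V'.
move=> yz TV VE; have [Vy nVz] := (setI_pairP V yz).1 VE.
have [W [TW Wz nWy]] := strongly_separate GT TV Vy nVz.
by exists V, W; split=> //; rewrite setUC; apply/(setI_pairP W (nesym yz)).
Qed.

(* The trivial pre-topology {set0, setT} makes every group a strongly
   pre-topological group, so the T_1 part of complete regularity needs a
   separation hypothesis; T_0 is necessary and is the only one assumed. *)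
Theorem theorem4p13 (R : realType) (G : groupType) (T : pretopology G) :
  strongly_pretopological_group T ->
  points_closed_functionally_separated R T /\
  (pre_T0 T -> completely_regular R T).
Proof.
move=> GT; have sep := strongly_functionally_separated R GT.
by split=> // T0; split=> //; exact: strongly_T0_T1.
Qed.
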